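(* Fix $r\ge 2$ and $n\ge r$, and assume the roots are translated so that $\sum_i x_i=0$. Then: (1) (subset average) $$J_{n,r}(t)=\binom nr^{-1}\sum_{\substack{S\subseteq\{1,\dots,n\}\\|S|=r}}\ \prod_{i\in S}(t-x_i).$$ (2) Equivalently, $$J_{n,r}(t)=t^r+\sum_{j=2}^r(-1)^j\frac{\binom rj}{\binom nj}e_jt^{r-j}=t^r+\sum_{j=2}^r(-1)^j\frac{(r)_{\downarrow j}}{(n)_{\downarrow j}}e_jt^{r-j}.$$ (3) Consequently $J_{n,r}$ is a universal polynomial in $p_2,\dots,p_r$ (i.e. its coefficients in $t$ are polynomials in $p_2,\dots,p_r$ with rational coefficients depending only on $n$ and $r$), and $$\mathcal D_{n-r}^{(n)}=\left(\frac{n!}{r!}\right)^{2r-2}\operatorname{disc}(J_{n,r}).$$ (4) With $J_{n,1}(t)=t$ and $J_{n,0}(t)=1$, one has the finite Appell relation $$J_{n,r}'(t)=r\,J_{n,r-1}(t),\qquad 1\le r\le n.$$ (5) In particular (for $2\le r\le n$), $$\operatorname{disc}(J_{n,r})=(-1)^{r(r-1)/2}\,r^r\operatorname{Res}(J_{n,r},J_{n,r-1}).$$ (6) If the roots $x_i$ are real, then all $J_{n,r}$ are real-rooted, and the zeros of consecutive members $J_{n,r-1},J_{n,r}$ interlace.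
   Context: Let $P(t)=\prod_{i=1}^n(t-x_i)$, where $\sum_i x_i=0$, and put $J_{n,r}(t)=\frac{r!}{n!}P^{(n-r)}(t)$. Here $e_j$ is the $j$-th elementary symmetric polynomial of $x_1,\dots,x_n$, $p_j=\sum_{i=1}^n x_i^j$ (so $p_1=e_1=0$), and $(m)_{\downarrow j}=m(m-1)\cdots(m-j+1)$ is the falling factorial. $\mathcal D_k^{(n)}=\operatorname{disc}(P^{(k)})=(-1)^{m(m-1)/2}c^{-1}\operatorname{Res}(P^{(k)},P^{(k+1)})$, where $m=n-k$ and $c$ is the leading coefficient of $P^{(k)}$. Interlacing is in the usual weak sense, zeros counted with multiplicity: if $u_1\le\dots\le u_r$ are the zeros of $J_{n,r}$ and $v_1\le\dots\le v_{r-1}$ those of $J_{n,r-1}$, then $u_1\le v_1\le u_2\le\dots\le v_{r-1}\le u_r$. *)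

(* Defs.v *)
From HB Require Import structures.
From mathcomp Require Import all_boot all_order all_algebra.
From mathcomp Require Import mpoly complex.

Set Implicit Arguments.
Unset Strict Implicit.
Unset Printing Implicit Defensive.

Import Order.TTheory GRing.Theory Num.Theory.

Local Open Scope ring_scope.

Section Jensen.
Variables (F : fieldType) (n : nat).
Implicit Types x : 'I_n -> F.

Definition rootpoly x : {poly F} := \prod_(i < n) ('X - (x i)%:P).

Definition jensen x (r : nat) : {poly F} :=
  (r`!%:R / n`!%:R) *: (rootpoly x)^`(n - r).

Definition elemsym x (j : nat) : F := (mesym n F j).@[x].

Definition psum x (j : nat) : F := \sum_(i < n) x i ^+ j.

End Jensen.

(* [resultant p q] is the determinant of the Sylvester matrix with coefficients
   in increasing order of degree; it differs from
   lead_coef p ^ deg q * \prod_(root a of p) q.[a] by the sign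
   (-1) ^ (deg p * deg q), which is 1 when deg q = deg p - 1. *)
Definition disc (F : fieldType) (p : {poly F}) : F :=
  let m := (size p).-1 in
  (-1) ^+ (m * m.-1)./2 * (lead_coef p)^-1 * resultant p p^`().

Definition deriv_disc (F : fieldType) (n : nat) (x : 'I_n -> F) (k : nat) : F :=
  disc (rootpoly x)^`(k).

Section RealZeros.
Variable R : rcfType.
Implicit Types (p q : {poly R[i]}) (u v : seq R).

Definition real_rooted p := forall z : R[i], root p z -> z \is Num.real.

Definition zeros_are p u :=
  p != 0 /\ p = lead_coef p *: \prod_(a <- u) ('X - (real_complex R a)%:P).

Definition interlace p q := exists u v,
  [/\ sorted <=%R u /\ sorted <=%R v,
      zeros_are p u, zeros_are q v,
      size u = (size v).+1
    & forall i, (i < size v)%N -> u`_i <= v`_i <= u`_i.+1].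

End RealZeros.

(* Main.v *)
Require Import Defs.
From mathcomp Require Import all_boot all_order all_algebra.
From mathcomp Require Import mpoly complex.
From mathcomp Require Import ring zify polyrcf.

Set Implicit Arguments.
Unset Strict Implicit.
Unset Printing Implicit Defensive.

Import Order.TTheory GRing.Theory Num.Theory.

Local Open Scope ring_scope.

(* Since J_r is a rescaled derivative of P, its coefficients follow from Vieta's
   formulas, and the Appell relation J_r' = r J_(r-1) turns the discriminant into
   a resultant of consecutive members by homogeneity of the Sylvester determinant.
   Newton's identities, in which p_1 = 0, make the coefficients universal
   polynomials in p_2, ..., p_r. Real-rootedness and interlacing descend from P = J_n
   one derivative at a time, by Rolle's theorem counted with multiplicity. *)

(** * Homogeneity of the resultant *)

(** Scaling multiplies the Sylvester matrix on the left by a block diagonal scalar matrix. The block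
    of [p] has deg q rows and that of [q] has deg p rows, whence the crossed exponents. *)
Lemma resultantZ (F : fieldType) (a b : F) (p q : {poly F}) :
  a != 0 -> b != 0 ->
  resultant (a *: p) (b *: q)
  = a ^+ (size q).-1 * b ^+ (size p).-1 * resultant p q.
Proof.
move=> a0 b0.
(* With the block sizes as parameters, the degrees of the scaled polynomials can be rewritten
   although they occur in the type of the matrix. *)
pose syl m n (f g : {poly F}) : 'M_(n + m) :=
  col_mx (lin1_mx (poly_rV \o f \o* rVpoly)) (lin1_mx (poly_rV \o g \o* rVpoly)).
have resE f g : resultant f g = \det (syl (size f).-1 (size g).-1 f g) by [].
rewrite !resE !size_scale //; move: (size p).-1 (size q).-1 => m n.
have -> : syl m n (a *: p) (b *: q)
        = block_mx a%:M 0 0 b%:M *m syl m n p q.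
  rewrite mul_block_col !mul0mx addr0 add0r !mul_scalar_mx.
  by congr col_mx; apply/matrixP=> i j; rewrite !mxE /= -scalerAr coefZ.
by rewrite det_mulmx det_ublock !det_scalar.
Qed.

(** * Coefficients, Appell relation and discriminants *)

Section Algebra.
Variables (F : numFieldType) (n : nat).
Implicit Types x : 'I_n -> F.

Lemma coef_rootpoly x j : (j <= n)%N ->
  (rootpoly x)`_(n - j) = (-1) ^+ j * elemsym x j.
Proof.
rewrite -ltnS => jn; have := mroots_coeff [tuple x i | i < n] (Ordinal jn).
rewrite big_tuple /=; under eq_bigr do rewrite tnth_mktuple.
by move=> ->; congr (_ * _); apply: meval_eq => i; rewrite tnth_mktuple.
Qed.

Lemma elemsym0 x : elemsym x 0 = 1.
Proof. by rewrite /elemsym mesym0E rmorph1. Qed.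

Lemma elemsym1 x : elemsym x 1 = \sum_(i < n) x i.
Proof.
by rewrite /elemsym mesym1E raddf_sum /=; apply: eq_bigr => i _; rewrite mevalXU.
Qed.

Lemma monic_rootpoly x : rootpoly x \is monic.
Proof. by apply: monic_prod => i _; apply: monicXsubC. Qed.

Lemma size_rootpoly x : size (rootpoly x) = n.+1.
Proof. by rewrite /rootpoly size_prod_XsubC /index_enum -enumT size_enum_ord. Qed.

(** Differentiating n - r times multiplies the Vieta coefficient by [(n - j) ^_ (n - r)]; once all
    falling factorials are quotients of factorials, the constants cancel. *)
Lemma coef_jensen x r j : (j <= r <= n)%N ->
  (jensen x r)`_(r - j)
  = (-1) ^+ j * ((r ^_ j)%:R / (n ^_ j)%:R) * elemsym x j.
Proof.
move=> /andP[jr rn]; rewrite /jensen coefZ coef_derivn.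
have -> : (n - r + (r - j) = n - j)%N by rewrite addnC addnBAC // subnKC.
rewrite coef_rootpoly ?(leq_trans jr) // -[X in _ * X]mulr_natr.
have natf_neq0 k : k`!%:R != 0 :> F by rewrite pnatr_eq0 -lt0n fact_gt0.
have rE : (r ^_ j)%:R = r`!%:R / (r - j)`!%:R :> F.
  by rewrite -(ffact_fact jr) natrM mulfK.
have nE : (n ^_ j)%:R = n`!%:R / (n - j)`!%:R :> F.
  by rewrite -(ffact_fact (leq_trans jr rn)) natrM mulfK.
have njE : ((n - j) ^_ (n - r))%:R = (n - j)`!%:R / (r - j)`!%:R :> F.
  rewrite -(@ffact_fact (n - j) (n - r)) ?leq_sub2l //.
  have -> : (n - j - (n - r) = r - j)%N by rewrite subnAC subKn.
  by rewrite natrM mulfK.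
by rewrite rE nE njE; field; rewrite !natf_neq0.
Qed.

Lemma size_jensen_leq x r : (r <= n)%N -> (size (jensen x r) <= r.+1)%N.
Proof.
move=> rn; apply: leq_trans (size_scale_leq _ _) _.
apply/leq_sizeP => j rj; rewrite coef_derivn nth_default ?mul0rn //.
by rewrite size_rootpoly -{1}(subnK rn) -addnS leq_add2l.
Qed.

Lemma jensen_ffact x r : (r <= n)%N ->
  jensen x r = \sum_(0 <= j < r.+1)
    ((-1) ^+ j * ((r ^_ j)%:R / (n ^_ j)%:R) * elemsym x j) *: 'X^(r - j).
Proof.
move=> rn; rewrite big_nat_rev /= big_mkord.
have -> : jensen x r = \sum_(i < r.+1) (jensen x r)`_i *: 'X^i.
  rewrite -poly_def; apply/polyP=> i; rewrite coef_poly; case: ltnP => // ri.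
  by rewrite nth_default // (leq_trans (size_jensen_leq x rn)).
apply: eq_bigr => [[i /= /ltnSE ir] _]; rewrite add0n subSS.
by rewrite -coef_jensen ?leq_subr // subKn.
Qed.

Lemma jensen_ffact2 x r : (2 <= r <= n)%N -> \sum_(i < n) x i = 0 ->
  jensen x r = 'X^r + \sum_(2 <= j < r.+1)
    ((-1) ^+ j * ((r ^_ j)%:R / (n ^_ j)%:R) * elemsym x j) *: 'X^(r - j).
Proof.
move=> /andP[r2 rn] x0; rewrite jensen_ffact // big_ltn // big_ltn ?ltnS 1?ltnW //.
by rewrite elemsym1 x0 mulr0 scale0r add0r elemsym0 !ffactn0 divr1 !mulr1 scale1r subn0.
Qed.

Lemma jensen1 x : (0 < n)%N -> \sum_(i < n) x i = 0 -> jensen x 1 = 'X.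
Proof.
move=> n0 x0; rewrite jensen_ffact // !big_nat_recr //= big_nil elemsym1 x0.
by rewrite elemsym0 mulr0 scale0r addr0 add0r !ffactn0 divr1 !mulr1 scale1r.
Qed.

Lemma jensen0 x : jensen x 0 = 1.
Proof.
rewrite jensen_ffact // !big_nat_recr //= big_nil.
by rewrite elemsym0 add0r !ffactn0 divr1 !mulr1 scale1r.
Qed.

Lemma coef_jensen_top x r : (r <= n)%N -> (jensen x r)`_r = 1.
Proof.
move=> rn; have := @coef_jensen x r 0.
by rewrite subn0 elemsym0 !ffactn0 divr1 !mulr1; apply.
Qed.

Lemma size_jensen x r : (r <= n)%N -> size (jensen x r) = r.+1.
Proof.
move=> rn; apply/eqP; rewrite eqn_leq size_jensen_leq // ltnNge.
apply/negP => /(nth_default 0)/eqP.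
by rewrite coef_jensen_top // oner_eq0.
Qed.

Lemma monic_jensen x r : (r <= n)%N -> jensen x r \is monic.
Proof. by move=> rn; rewrite monicE lead_coefE size_jensen // coef_jensen_top. Qed.

Lemma deriv_jensen x r : (1 <= r <= n)%N ->
  (jensen x r)^`() = r%:R *: jensen x r.-1.
Proof.
case: r => // r /= rn; rewrite /jensen derivZ -derivnS scalerA.
by rewrite subnSK // factS natrM mulrA.
Qed.

(** The factor r of the derivative leaves the resultant with exponent r, the degree of
    [jensen x r]. *)
Lemma disc_jensen x r : (1 <= r <= n)%N ->
  disc (jensen x r) = (-1) ^+ (r * r.-1)./2 * r%:R ^+ r
                      * resultant (jensen x r) (jensen x r.-1).
Proof.
move=> rn; have [r0 rn'] := andP rn.
rewrite /disc deriv_jensen // (monicP (monic_jensen x rn')) size_jensen //=.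
rewrite -[X in resultant X]scale1r resultantZ ?oner_eq0 ?pnatr_eq0 -?lt0n //.
rewrite scale1r !size_jensen ?(leq_trans (leq_pred r)) //=.
by rewrite divr1 expr1n mul1r mulrA.
Qed.

Lemma deriv_disc_jensen x r : (1 <= r <= n)%N ->
  deriv_disc x (n - r)
  = (n`!%:R / r`!%:R) ^+ (2 * r - 2) * disc (jensen x r).
Proof.
move=> /andP[r0 rn]; set c := _ / _.
have c0 : c != 0.
  by rewrite mulf_neq0 ?invr_eq0 ?pnatr_eq0 // -lt0n fact_gt0.
have -> : deriv_disc x (n - r) = disc (c *: jensen x r).
  have cV : r`!%:R / n`!%:R = c^-1 by rewrite invf_div.
  by rewrite /jensen cV scalerA mulfV // scale1r.
(* The resultant yields c^(r-1) from the polynomial and c^r from its derivative; dividing by the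
   leading coefficient c leaves c^(2r-2). *)
rewrite /disc derivZ lead_coefZ (monicP (monic_jensen x rn)) resultantZ //.
rewrite size_scale // size_jensen //=.
rewrite deriv_jensen ?r0 // size_scale ?pnatr_eq0 -?lt0n // size_jensen; last first.
  exact: leq_trans (leq_pred _) rn.
rewrite invfM -(prednK r0) /= mulnS addKn mul2n -addnn exprD.
by rewrite exprS; field; rewrite c0.
Qed.

End Algebra.

(** * Divided derivatives and subset averages *)

(* Both sides are the coefficient of Y^(n-k) in P(X+Y) = \prod_i (Y + (X - x_i)):
   the left one by Taylor's formula, the right one by expanding the product. *)
Lemma nderivn_prod_XsubC (F : comNzRingType) (n k : nat) (x : 'I_n -> F) :
  (k <= n)%N ->
  (\prod_(i < n) ('X - (x i)%:P))^`N(n - k)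
  = \sum_(S : {set 'I_n} | #|S| == k) \prod_(i in S) ('X - (x i)%:P).
Proof.
move=> kn; set P := \prod_(i < n) _.
(* In [{poly {poly F}}] the inner variable plays X and the outer one Y, so that [P2.['X%:P + 'X]] is
   P(X+Y). *)
pose P2 := map_poly (polyC \o polyC) P.
have EL : P2.['X%:P + 'X]`_(n - k) = P^`N(n - k).
  have szP : size P = n.+1.
    by rewrite /P size_prod_XsubC /index_enum -enumT size_enum_ord.
  have szP2 : (size P2 <= n.+1)%N by rewrite (leq_trans (size_poly _ _)) ?szP.
  rewrite (@nderiv_taylor_wide _ n.+1) //; last exact: mulrC.
  have -> : \sum_(i < n.+1) P2^`N(i).['X%:P] * 'X^i = \poly_(i < n.+1) P^`N(i).
    rewrite poly_def; apply: eq_bigr => i _; rewrite -mul_polyC; congr (_ * _).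
    rewrite /P2 nderivn_map; move: (P^`N(i)) => Q.
    by rewrite map_poly_comp horner_map /= -/(Q \Po 'X) comp_polyXr.
  by rewrite coef_poly ltnS leq_subr.
have ER : P2.['X%:P + 'X] = \sum_(S : {set 'I_n})
    (\prod_(i in S) ('X - (x i)%:P)) *: 'X^(n - #|S|).
  rewrite /P2 /P rmorph_prod horner_prod.
  have -> : \prod_(i < n) (map_poly (polyC \o polyC) ('X - (x i)%:P)).['X%:P + 'X]
          = \prod_(i < n) (('X - (x i)%:P)%:P + 'X).
    apply: eq_bigr => i _; rewrite rmorphB /= map_polyX map_polyC /= hornerXsubC.
    by rewrite polyCB addrAC.
  (* [S] collects the indices whose factor contributes X - x_i; the others contribute Y. *)
  rewrite bigA_distr; apply: eq_bigr => S _; rewrite (bigID (mem S)) /=.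
  rewrite -mul_polyC rmorph_prod; congr (_ * _).
    by apply: eq_bigr => i ->.
  rewrite (eq_bigr (fun=> 'X)) => [|i /negPf -> //].
  rewrite prodr_const; congr (_ ^+ _).
  by have /(congr1 (subn^~ #|S|)) := cardC (mem S); rewrite card_ord addKn.
rewrite -EL ER coef_sum [in RHS]big_mkcond; apply: eq_bigr => S _.
rewrite coefZ coefXn.
have Sn : (#|S| <= n)%N by have := max_card (mem S); rewrite card_ord.
have -> : (n - k == n - #|S|)%N = (#|S| == k).
  by apply/eqP/eqP => [e|-> //]; rewrite -(subKn Sn) -e subKn.
by case: eqP; rewrite (mulr1, mulr0).
Qed.

(** Ordinary and divided derivatives differ by (n - r)!, which turns r!/n! into the inverse binomial
    coefficient. *)
Lemma jensen_subset_average (F : numFieldType) (n r : nat) (x : 'I_n -> F) :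
  (r <= n)%N ->
  jensen x r = 'C(n, r)%:R^-1 *:
    \sum_(S : {set 'I_n} | #|S| == r) \prod_(i in S) ('X - (x i)%:P).
Proof.
move=> rn; rewrite -nderivn_prod_XsubC // /jensen nderivn_def -scaler_nat scalerA.
congr (_ *: _); rewrite -(bin_fact rn) !natrM.
have f0 k : k`!%:R != 0 :> F by rewrite pnatr_eq0 -lt0n fact_gt0.
by field; rewrite !f0 pnatr_eq0 -lt0n bin_gt0 rn.
Qed.

(** * Newton's identities and universal coefficients *)

(* Synthetic division: the quotient coefficients telescope. *)
Lemma coef_divXsubC (R : comNzRingType) (a : R) (q : {poly R}) (n m : nat) :
  (size q <= n)%N -> (m <= n)%N ->
  q`_m = \sum_(m <= l < n) (q * ('X - a%:P))`_l.+1 * a ^+ (l - m).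
Proof.
move=> sz mn; pose f l := - (q`_l * a ^+ (l - m)).
rewrite (eq_big_nat _ _ (F2 := fun l => f l.+1 - f l)).
  rewrite telescope_sumr // /f (nth_default _ sz) mul0r oppr0 sub0r opprK.
  by rewrite subnn mulr1.
move=> l /andP[ml _]; rewrite mulrBr coefB coefMX coefMC /= /f subSn // exprS.
by ring.
Qed.

Lemma deriv_rootpoly (F : fieldType) (n : nat) (x : 'I_n -> F) :
  (rootpoly x)^`() = \sum_(i < n) \prod_(j < n | j != i) ('X - (x j)%:P).
Proof.
rewrite /rootpoly; elim: n x => [|n IHn] x; first by rewrite !big_ord0 derivC.
rewrite big_ord_recl derivM derivXsubC mul1r IHn big_ord_recl; congr (_ + _).
  rewrite [RHS]big_mkcond big_ord_recl /= mul1r; apply: eq_bigr => i _.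
  by [].
rewrite mulr_sumr; apply: eq_bigr => i _; rewrite [RHS]big_mkcond big_ord_recl /=.
congr (_ * _); rewrite -big_mkcond; apply: eq_bigl => j.
by rewrite (inj_eq lift_inj).
Qed.

(* Compare coefficients in X * P' = \sum_i X * Q_i = \sum_i (P + x_i * Q_i),
   where Q_i = P / (X - x_i). *)
Lemma newton_rootpoly (F : fieldType) (n : nat) (x : 'I_n -> F) (k : nat) :
  (k <= n)%N ->
  k%:R * (rootpoly x)`_(n - k)
  = - \sum_(i < k) (rootpoly x)`_(n - i) * psum x (k - i).
Proof.
move=> kn; set P := rootpoly x; set m := (n - k)%N.
pose Q i := \prod_(j < n | j != i) ('X - (x j)%:P).
have PQ i : P = Q i * ('X - (x i)%:P) by rewrite /P /rootpoly (bigD1 i) //= mulrC.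
have szQ i : (size (Q i) <= n)%N.
  have : size (Q i * ('X - (x i)%:P)) = n.+1.
    by rewrite -PQ /P /rootpoly size_prod_XsubC /index_enum -enumT size_enum_ord.
  have Q_monic : Q i \is monic by apply: monic_prod => j _; apply: monicXsubC.
  rewrite size_Mmonic ?monicXsubC ?monic_neq0 // size_XsubC addn2 => -[->].
  exact: leqnn.
have XP' : P`_m *+ m = \sum_(i < n) (P`_m + x i * (Q i)`_m).
  have -> : P`_m *+ m = ('X * P^`())`_m.
    by rewrite coefXM coef_deriv; case: (m).
  rewrite deriv_rootpoly mulr_sumr coef_sum; apply: eq_bigr => i _.
  have -> : 'X * \prod_(j < n | j != i) ('X - (x j)%:P) = P + (x i)%:P * Q i.
    by rewrite (PQ i) /Q; ring.
  by rewrite coefD coefCM.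
(* Since n = k + m, cancelling m copies of the coefficient leaves k of them. *)
have {XP'} -> : k%:R * P`_m = - \sum_(i < n) x i * (Q i)`_m.
  move: XP'; rewrite big_split /= sumr_const card_ord.
  have -> : P`_m *+ n = P`_m *+ k + P`_m *+ m by rewrite -mulrnDr subnKC.
  rewrite addrAC -{1}[_ *+ m]add0r => /addIr e.
  by apply/eqP; rewrite -addr_eq0 mulr_natl -e.
congr (- _).
(* Synthetic division writes each coefficient of [Q i] through those of P and powers of x_i; summing
   over i produces power sums. *)
have -> : \sum_(i < n) x i * (Q i)`_m = \sum_(m <= l < n) P`_l.+1 * psum x (l.+1 - m).
  under [RHS]eq_bigr do rewrite /psum mulr_sumr.
  rewrite exchange_big /=; apply: eq_bigr => i _.
  rewrite (coef_divXsubC (x i) (szQ i) (leq_subr k n)) -PQ mulr_sumr.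
  by apply: eq_big_nat => l /andP[ml _]; rewrite subSn // exprS; ring.
rewrite big_nat_rev /= -{1}[m]add0n big_addn big_mkord /m subKn //.
apply: eq_bigr => [[i ik] _] /=; congr (P`__ * psum x _); lia.
Qed.

(** Strong induction through Newton's identities, k being invertible in [rat]. Universality lies in
    choosing [c] before the field, the roots and [ev]. *)
Lemma coef_rootpoly_psum (n N k : nat) : (k <= n)%N -> (k <= N.+1)%N ->
  exists c : {mpoly rat[N]},
    forall (F : numFieldType) (x : 'I_n -> F) (ev : {rmorphism {mpoly rat[N]} -> F}),
    \sum_(i < n) x i = 0 -> (forall i : 'I_N, ev 'X_i = psum x i.+2) ->
    (rootpoly x)`_(n - k) = ev c.
Proof.
elim/ltn_ind: k => k IHk kn kN.
have [->|k0] := posnP k.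
  exists 1 => F x ev _ _; rewrite rmorph1 subn0.
  by have := monicP (monic_rootpoly x); rewrite lead_coefE size_rootpoly.
have [] := @fin_all_exists 'I_k _ _ (fun i : 'I_k => IHk i (ltn_ord i)
  (leq_trans (ltnW (ltn_ord i)) kn) (leq_trans (ltnW (ltn_ord i)) kN)).
move=> c cE.
(* [pw j] stands for p_j, with value 0 at j = 1 because p_1 = 0. The indices k - i lie between 1 and
   N + 1, so every other one hits a variable. *)
pose pw j : {mpoly rat[N]} :=
  if j is j'.+2 then if insub j' is Some i then 'X_i else 0 else 0.
exists (- ((k%:R^-1)%:MP * \sum_(i < k) c i * pw (k - i)%N)) => F x ev x0 evX.
have pwE j : (0 < j <= k)%N -> ev (pw j) = psum x j.
  case: j => [|[|j]] //= jk.
    by rewrite rmorph0 /psum -[LHS]x0; apply: eq_bigr => i _; rewrite expr1.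
  case: insubP => [i _ ij|]; first by rewrite evX ij.
  by rewrite -ltnS (leq_trans jk).
have kF0 : k%:R != 0 :> F by rewrite pnatr_eq0 -lt0n.
have kQ0 : k%:R != 0 :> rat by rewrite pnatr_eq0 -lt0n.
(* [ev] is only a ring morphism, so the image of the constant 1/k is identified by its product with
   k. *)
have evV : k%:R * ev (k%:R^-1)%:MP = 1.
  rewrite -(rmorph_nat ev) -rmorphM -(rmorph_nat (@mpolyC N rat)) -rmorphM.
  by rewrite mulfV // !rmorph1.
apply: (mulfI kF0); rewrite newton_rootpoly // rmorphN rmorphM mulrN mulrA evV mul1r.
congr (- _); rewrite rmorph_sum; apply: eq_bigr => i _.
by rewrite rmorphM (cE i F x ev) // pwE // subn_gt0 ltn_ord leq_subr.
Qed.

Lemma coef_jensen_psum (n r : nat) : (2 <= r <= n)%N ->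
  exists U : {poly {mpoly rat[r.-1]}},
    forall (F : numFieldType) (x : 'I_n -> F) (ev : {rmorphism {mpoly rat[r.-1]} -> F}),
    \sum_(i < n) x i = 0 -> (forall i : 'I_r.-1, ev 'X_i = psum x i.+2) ->
    forall j : nat, (jensen x r)`_j = ev U`_j.
Proof.
move=> /andP[r2 rn].
have [] := @fin_all_exists 'I_r.+1 _ _ (fun k : 'I_r.+1 =>
  @coef_rootpoly_psum n r.-1 k (leq_trans (leq_ord k) rn)
    (leq_trans (leq_ord k) (leqSpred r))).
move=> c cE; pose d : rat := r`!%:R / n`!%:R.
(* The coefficient of degree j comes from degree n - r + j = n - (r - j) of P; as r - j <= r, only
   p_2, ..., p_r enter. *)
exists (\poly_(j < r.+1) (d%:MP * (c (inord (r - j)) *+ (n - r + j) ^_ (n - r)))).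
move=> F x ev x0 evX j; rewrite coef_poly ltnS; case: leqP => [jr|rj]; last first.
  by rewrite rmorph0 nth_default // size_jensen.
have evd : ev d%:MP = r`!%:R / n`!%:R.
  have nF0 : n`!%:R != 0 :> F by rewrite pnatr_eq0 -lt0n fact_gt0.
  have nQ0 : n`!%:R != 0 :> rat by rewrite pnatr_eq0 -lt0n fact_gt0.
  apply: (mulIf nF0); rewrite divfK //.
  rewrite -!(rmorph_nat ev) -rmorphM -!(rmorph_nat (@mpolyC r.-1 rat)) -rmorphM.
  by rewrite divfK.
rewrite /jensen coefZ coef_derivn rmorphM evd rmorphMn; congr (_ * (_ *+ _)).
rewrite -(cE _ F x ev) //; congr (polyseq _)`__.
by rewrite inordK ?ltnS ?leq_subr //; lia.
Qed.

(** * Rolle's theorem with multiplicities *)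

(** Peel off one root at a time: dividing by X - b lowers the multiplicity of b alone, by one, as
    removing b from the list lowers its count. *)
Lemma dvdp_prod_XsubC (F : fieldType) (s : seq F) (p : {poly F}) : p != 0 ->
  (forall a, (count_mem a s <= mup a p)%N) -> \prod_(a <- s) ('X - a%:P) %| p.
Proof.
elim: s p => [|b s IHs] p p0 le_s; first by rewrite big_nil dvd1p.
have : 'X - b%:P %| p by rewrite XsubC_dvd // (leq_trans _ (le_s b)) //= eqxx.
rewrite dvdp_eq; move: (p %/ _) => q /eqP pE; rewrite big_cons mulrC.
subst p; have q0 : q != 0 by apply: contraNneq p0 => ->; rewrite mul0r.
apply: dvdp_mul => //; apply: IHs => // a.
have := le_s a; rewrite mupM ?polyXsubC_eq0 // (@mup_XsubCX _ 1) /=.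
by rewrite addnC; case: (b == a); rewrite /= leq_add2r.
Qed.

Lemma mup_deriv (F : fieldType) (a : F) (p : {poly F}) : p != 0 -> p^`() != 0 ->
  ((mup a p).-1 <= mup a p^`())%N.
Proof.
move=> p0 p'0; rewrite mup_geq //.
have : ('X - a%:P) ^+ mup a p %| p by rewrite -mup_geq.
rewrite dvdp_eq => /eqP pE; rewrite [in X in _ %| X]pE derivM.
apply: dvdp_add; first by apply/dvdp_mull/dvdp_exp2l/leq_pred.
rewrite deriv_exp derivXsubC mul1r.
by apply: dvdp_mull; rewrite -mulr_natr dvdp_mulr.
Qed.

Section Rolle.
Variable R : rcfType.
Implicit Types (p : {poly R}) (u v s : seq R).

(* A critical point v_i chosen by Rolle's theorem strictly inside a gap is simple
   in v, while an a repeated k times in a :: s accounts for k - 1 elements of v. *)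
Lemma rolle_seq p a s : path <=%R a s -> all (root p) (a :: s) ->
  exists v, [/\ size v = size s, path <=%R a v,
    forall i, (i < size v)%N -> (a :: s)`_i <= v`_i <= (a :: s)`_i.+1
  & forall c, if c \in a :: s then (count_mem c v < count_mem c (a :: s))%N
              else (count_mem c v <= root p^`() c)%N].
Proof.
elim: s a => [|b s IHs] a.
  by exists [::]; split=> // c; rewrite inE /= eq_sym; case: eqP.
move=> /= /andP[ab bs] /and3P[ra rb rs].
have [|v [sz_v bv itl cnt]] := IHs b bs; first by rewrite /= rb.
have ltb c t : path <=%R b t -> c < b -> c \notin t.
  move=> bt cb; apply/negP => ct.
  have /allP/(_ c ct) := order_path_min le_trans bt.
  by rewrite leNgt cb.
have [eab|nab] := eqVneq a b.
  (* A repeated root is itself the critical point between its two copies. *)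
  subst b; exists (a :: v); split=> /=; rewrite ?sz_v ?lexx //.
    by case=> [|i] /= ?; [rewrite lexx | apply: itl; rewrite sz_v].
  move=> c; have := cnt c; rewrite !inE orbA orbb.
  by case: ifP => //; rewrite /= ?ltn_add2l // => /norP[/negPf]; rewrite eq_sym => ->.
have {ab} ab : a < b by rewrite lt_neqAle nab.
have [|w] := poly_rolle (p := p) ab; first by rewrite (rootP ra) (rootP rb).
rewrite in_itv /= => /andP[aw wb] w0.
have wv : path <=%R w v by apply: path_le bv => //; [exact: le_trans | exact: ltW].
exists (w :: v); split=> /=; rewrite ?sz_v ?(ltW aw) //.
  by case=> [|i] /= ?; [rewrite !ltW | apply: itl; rewrite sz_v].
move=> c; rewrite !inE.
have [->|ca] := eqVneq c a.
  rewrite (gt_eqF aw) (gt_eqF ab) /= add0n (count_memPn _) //.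
  exact: ltb bv ab.
have [->|cw] := eqVneq c w.
  rewrite (lt_eqF wb) (negPf (ltb _ _ bs wb)) /= (count_memPn (ltb _ _ bv wb)).
  by rewrite addn0 rootE w0 eqxx.
by have := cnt c; rewrite inE /= !add0n.
Qed.

Lemma deriv_prod_XsubC_interlace u : (0 < size u)%N -> sorted <=%R u ->
  exists v, [/\ sorted <=%R v, size u = (size v).+1,
    forall i, (i < size v)%N -> u`_i <= v`_i <= u`_i.+1
  & (\prod_(a <- u) ('X - a%:P))^`()
    = (size u)%:R *: \prod_(a <- v) ('X - a%:P)].
Proof.
case: u => // a s _ /= as_; set p := \prod_(b <- _) _.
have p_monic : p \is monic by exact: monic_prod_XsubC.
have sz_p : size p = (size s).+2 by rewrite size_prod_XsubC.
have [|v [sz_v av itl cnt]] := @rolle_seq p a s as_.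
  by apply/allP => b; rewrite -root_prod_XsubC.
have lead_p' : p^`()`_(size s) = (size s).+1%:R.
  rewrite coef_deriv (_ : p`__ = 1) //.
  by have := monicP p_monic; rewrite lead_coefE sz_p.
have p'0 : p^`() != 0.
  by apply/eqP => p'0; move: lead_p'; rewrite p'0 coef0 => /esym/eqP; rewrite pnatr_eq0.
have sz_p' : size p^`() = (size s).+1.
  apply/eqP; rewrite eqn_leq -ltnS -sz_p lt_size_deriv ?monic_neq0 //= ltnNge.
  by apply/negP => /(nth_default 0)/eqP; rewrite lead_p' pnatr_eq0.
exists v; split; rewrite ?sz_v //; first exact: path_sorted av.
  by move=> i ilt; apply: itl; rewrite sz_v.
(* A root of p occurs in [v] at most its multiplicity minus one times, which [mup_deriv] allows; any
   other point occurs at most once, and only if it is a root of p'. *)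
have dvd : \prod_(c <- v) ('X - c%:P) %| p^`().
  apply: dvdp_prod_XsubC => // c; have := cnt c; case: ifP => [ci lt|_ le].
    apply: leq_trans (mup_deriv c (monic_neq0 p_monic) p'0).
    by rewrite mu_prod_XsubC -ltnS (leq_trans lt) // leqSpred.
  apply: leq_trans le _; case: rootP => //= rc.
  by rewrite -XsubC_dvd // dvdp_XsubCl; apply/rootP.
(* Equal sizes upgrade divisibility to proportionality; the leading coefficient of p' fixes the
   factor. *)
have := dvdp_size_eqp dvd; rewrite size_prod_XsubC sz_v sz_p' eqxx => /esym/eqp_eq.
rewrite (monicP (monic_prod_XsubC _ _ _)) scale1r => <-.
by rewrite lead_coefE sz_p' lead_p'.
Qed.

End Rolle.

(** * Real-rootedness and interlacing *)

Section RealRoots.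
Variables (R : rcfType) (n : nat) (x : 'I_n -> R[i]).

(** Rolle's theorem works over [R]: the factorization is differentiated there and sent back along
    [real_complex], and the factor r of the Appell relation is cancelled. *)
Lemma jensen_pred_zeros r u : (1 <= r <= n)%N -> sorted <=%R u -> size u = r ->
  jensen x r = \prod_(a <- u) ('X - (real_complex R a)%:P) ->
  exists v, [/\ sorted <=%R v, size u = (size v).+1,
    forall i, (i < size v)%N -> u`_i <= v`_i <= u`_i.+1
  & jensen x r.-1 = \prod_(a <- v) ('X - (real_complex R a)%:P)].
Proof.
move=> rn su szu Ju.
have mapE s : \prod_(a <- s) ('X - (real_complex R a)%:P)
            = map_poly (real_complex R) (\prod_(a <- s) ('X - a%:P)).
  by rewrite rmorph_prod; apply: eq_bigr => a _; rewrite rmorphB /= map_polyX map_polyC.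
have [r0 _] := andP rn.
have [|v [sv szv itl Ev]] := deriv_prod_XsubC_interlace _ su; first by rewrite szu.
exists v; split=> //; have rC0 : r%:R != 0 :> R[i] by rewrite pnatr_eq0 -lt0n.
apply: (scalerI rC0); rewrite -deriv_jensen // Ju !mapE deriv_map Ev szu.
by rewrite map_polyZ rmorph_nat.
Qed.

Hypothesis x_real : forall i, x i \is Num.real.

Lemma jensen_zeros r : (r <= n)%N ->
  exists u, [/\ sorted <=%R u, size u = r
    & jensen x r = \prod_(a <- u) ('X - (real_complex R a)%:P)].
Proof.
(* Writing r as n - (n - r) turns the descent from J_n = P into an induction on the number of
   derivatives. *)
move=> rn; rewrite -(subKn rn); elim: (n - r)%N => [|k [u [su szu Ju]]].
  exists (sort <=%R [seq complex.Re (x i) | i <- enum 'I_n]).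
  split; first exact: (sort_sorted le_total).
    by rewrite subn0 size_sort size_map size_enum_ord.
  rewrite (perm_big _ (permEl (perm_sort _ _))) /= big_map subn0.
  rewrite /jensen subnn derivn0 divff ?pnatr_eq0 -?lt0n ?fact_gt0 // scale1r.
  rewrite /rootpoly -big_enum /=; apply: eq_bigr => i _.
  by rewrite RRe_real.
(* If n - k is already 0, its truncated predecessor is 0 too and the same list serves. *)
rewrite subnS; have [nk0|nk0] := posnP (n - k)%N.
  by exists u; split; rewrite ?szu // -?Ju nk0.
have [|v [sv szv _ Jv]] := jensen_pred_zeros _ su szu Ju.
  by rewrite nk0 leq_subr.
by exists v; split=> //; rewrite -szu szv.
Qed.

Lemma real_rooted_jensen r : (r <= n)%N -> real_rooted (jensen x r).
Proof.
move=> /jensen_zeros[u [_ _ ->]] z.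
rewrite -(big_map (real_complex R) xpredT (fun a => 'X - a%:P)) root_prod_XsubC.
by case/mapP => a _ ->; apply/complex_realP; exists a.
Qed.

Lemma interlace_jensen r : (1 <= r <= n)%N -> interlace (jensen x r) (jensen x r.-1).
Proof.
move=> rn; have [r0 rn'] := andP rn; have [u [su szu Ju]] := jensen_zeros rn'.
have [v [sv szv itl Jv]] := jensen_pred_zeros rn su szu Ju.
have zeros k s : (k <= n)%N ->
    jensen x k = \prod_(a <- s) ('X - (real_complex R a)%:P) ->
    zeros_are (jensen x k) s.
  move=> kn Js; have Jmonic := monic_jensen x kn.
  by split; [exact: monic_neq0 | rewrite (monicP Jmonic) scale1r].
by exists u, v; split=> //; apply: zeros => //; rewrite (leq_trans (leq_pred r)).
Qed.

End RealRoots.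

Theorem theorem12 (n : nat) (n_gt0 : (0 < n)%N) :
  (* the universal polynomial of (3): variable i of {mpoly rat[r.-1]} is p_(i+2) *)
  (forall r : nat, (2 <= r <= n)%N ->
     exists U : {poly {mpoly rat[r.-1]}},
       forall (R : rcfType) (x : 'I_n -> R[i]), \sum_(i < n) x i = 0 ->
       forall j : nat,
         (jensen x r)`_j
         = (map_mpoly ratr U`_j).@[fun i : 'I_r.-1 => psum x i.+2]) /\
  (forall (R : rcfType) (x : 'I_n -> R[i]), \sum_(i < n) x i = 0 ->
     (forall r : nat, (2 <= r <= n)%N ->
       [/\ (* (1) *)
           jensen x r
           = 'C(n, r)%:R^-1 *:
             \sum_(S : {set 'I_n} | #|S| == r) \prod_(i in S) ('X - (x i)%:P),
           (* (2) *)
           jensen x r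
           = 'X^r + \sum_(2 <= j < r.+1)
               ((-1) ^+ j * ('C(r, j)%:R / 'C(n, j)%:R) * elemsym x j) *: 'X^(r - j)
         , jensen x r
           = 'X^r + \sum_(2 <= j < r.+1)
               ((-1) ^+ j * ((r ^_ j)%:R / (n ^_ j)%:R) * elemsym x j) *: 'X^(r - j),
           (* (3) *)
           deriv_disc x (n - r)
           = (n`!%:R / r`!%:R) ^+ (2 * r - 2) * disc (jensen x r)
         & (* (5) *)
           disc (jensen x r)
           = (-1) ^+ (r * r.-1)./2 * r%:R ^+ r
             * resultant (jensen x r) (jensen x r.-1)]) /\
     (* (4) *)
     [/\ jensen x 1 = 'X, jensen x 0 = 1
       & forall r : nat, (1 <= r <= n)%N ->
           (jensen x r)^`() = r%:R *: jensen x r.-1] /\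
     (* (6) *)
     ((forall i : 'I_n, x i \is Num.real) ->
        (forall r : nat, (r <= n)%N -> real_rooted (jensen x r)) /\
        (forall r : nat, (1 <= r <= n)%N ->
           interlace (jensen x r) (jensen x r.-1)))).

Proof.
split=> [r rn|R x x0].
  have [U UE] := coef_jensen_psum rn; exists U => R x x0 j.
  (* Base change from [rat] followed by evaluation at the power sums is an instance of the abstract
     morphism. *)
  pose ev : {rmorphism {mpoly rat[r.-1]} -> R[i]} :=
    (meval (fun i : 'I_r.-1 => psum x i.+2) \o map_mpoly ratr).
  apply: (UE _ x ev) => // i.
  by rewrite /ev /= map_mpolyX mevalXU.
split; last split.
- move=> r rn; have [r2 rn'] := andP rn.
  have r1n : (1 <= r <= n)%N by rewrite rn' ltnW.
  split.
  + exact: jensen_subset_average.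
  + rewrite jensen_ffact2 //; congr (_ + _); apply: eq_big_nat => j /andP[_ jr].
    have jF0 : j`!%:R != 0 :> R[i] by rewrite pnatr_eq0 -lt0n fact_gt0.
    by rewrite -!bin_ffact !natrM -mulf_div divff // mulr1.
  + exact: jensen_ffact2.
  + exact: deriv_disc_jensen.
  + exact: disc_jensen.
- by split=> [||r rn]; [exact: jensen1 | exact: jensen0 | exact: deriv_jensen].
- by move=> xR; split=> r rn; [exact: real_rooted_jensen | exact: interlace_jensen].
Qed.
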